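(* Let $b\in\mathbb{N}_0$ and $v,w\in(0,1]$. For $x\in\mathbb{Z}$, $$E_x\big[v^{\tilde\tau_b^+}w^{R_*(\tilde\tau_b^+)};\tilde\tau_b^+<\infty\big]=\begin{cases}\dfrac{Z_v(x,w)}{Z_v(b,w)}, & x\le b,\\[2mm] 1, & x>b.\end{cases}$$
   Context: Notation: $\mathbb{N}=\{1,2,\dots\}$, $\mathbb{N}_0=\{0,1,2,\dots\}$; $E[Y;A]:=E[Y\mathbf{1}_A]$; $\inf\emptyset=\infty$. Let $(p_k)_{k\in\mathbb{N}_0}$ be a probability mass function on $\mathbb{N}_0$ with $p_0>0$, and let $C_1,C_2,\dots$ be i.i.d. with $P(C_1=k)=p_k$. Let $X_n=X_0+n-\sum_{i=1}^nC_i$, $n\in\mathbb{N}_0$; for $x\in\mathbb{Z}$, $P_x$ (expectation $E_x$) is the law under which $X_0=x$, and $P=P_0$, $E=E_0$. For $b\in\mathbb{Z}$ let $\tau_b^-=\inf\{n\in\mathbb{N}_0:X_n\le b\}$ and $\tau_b^+=\inf\{n\in\mathbb{N}_0:X_n\ge b\}$. For $v\in(0,1]$: $W_v(y):=\big(p_0E[v^{\tau_y^+};\tau_y^+<\tau_{-1}^-]\big)^{-1}$ for $y\in\mathbb{N}_0$, and $W_v(y):=0$ for integers $y<0$. For $v,w\in(0,1]$ and $x\in\mathbb{Z}$: $\Psi_v(x,w):=E_x[v^{\tau_{-1}^-}w^{-X(\tau_{-1}^-)};\tau_{-1}^-<\infty]$ and $Z_v(x,w):=\Psi_v(x,w)+\alpha_v(w)W_v(x)$,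 where the constant $\alpha_v(w)\in[0,\infty)$ is chosen so that $Z_v(0,w)=1$. Reflection at $0$: $R_*(n):=\max\big(-\inf_{m\le n}X_m,0\big)$, $n\in\mathbb{N}_0$, are the cumulative capital injections. The process $\tilde X$ reflected at $0$ is given by $\tilde X_0=\max(X_0,0)$ and $\tilde X_{k+1}=\max(\tilde X_k+1-C_{k+1},0)$ (that is, $\tilde X_n=X_n+R_*(n)$), and $\tilde\tau_b^+:=\inf\{n\in\mathbb{N}_0:\tilde X_n\ge b\}$. *)

(* Defs.v *)
From HB Require Import structures.
From mathcomp Require Import all_boot all_order all_algebra.
From mathcomp Require Import all_classical all_reals all_analysis.

Set Implicit Arguments.
Unset Strict Implicit.
Unset Printing Implicit Defensive.

Import Order.TTheory GRing.Theory Num.Theory.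
Local Open Scope classical_set_scope.
Local Open Scope ring_scope.

Definition is_pmf (R : realType) (p : nat -> R) : Prop :=
  (forall k, 0 <= p k) /\ (\sum_(0 <= k <oo) (p k)%:E = 1)%E.

(* Times with values in N_0 U {oo}; None stands for oo. *)
Definition first_time (A : pred nat) : option nat :=
  if pselect (exists n, A n) is left exA then Some (ex_minn exA) else None.

Definition before (s t : option nat) : bool :=
  match s, t with
  | Some m, Some n => (m < n)%N
  | Some _, None => true
  | None, _ => false
  end.

(* Value of a finite time; only used on the event that t is finite. *)
Definition time_val (t : option nat) : nat := odflt 0%N t.

Section Walk.
Context (d : measure_display) (T : measurableType d) (R : realType).
Context (P : probability T R).

Definition mutually_independent (d' : measure_display)
    (S : measurableType d') (Y : nat -> {RV P >-> S}) : Prop :=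
  forall (J : seq nat) (B : nat -> set S),
    uniq J -> (forall j, measurable (B j)) ->
    P (\bigcap_(j in [set` J]) (Y j @^-1` B j)) =
    (\prod_(j <- J) P (Y j @^-1` B j))%E.

(* The notation E[Y; A]. *)
Definition expect_on (Y : T -> R) (A : set T) : R :=
  fine ('E_P[fun omega => (Y omega * \1_A omega)%R])%E.

(* C i is the (i+1)-st claim C_{i+1}. The law P_x is realised on the single
   space (T, P) by starting the walk at x, so that E_x[F(X)] is the
   P-expectation of F(X^x), with X^x the process [walk x]. *)
Context (C : nat -> T -> nat).

Definition walk (x : int) (n : nat) (omega : T) : int :=
  x + n%:Z - \sum_(i < n) (C i omega)%:Z.

(* tau_b^- and tau_b^+ under P_x. *)
Definition tau_dn (x b : int) (omega : T) : option nat :=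
  first_time (fun n => walk x n omega <= b).

Definition tau_up (x b : int) (omega : T) : option nat :=
  first_time (fun n => b <= walk x n omega).

(* p0 is the mass at 0 of the claim law. *)
Definition W (p0 v : R) (y : int) : R :=
  if 0 <= y then
    (p0 * expect_on (fun omega => v ^+ time_val (tau_up 0 y omega))
            [set omega | before (tau_up 0 y omega) (tau_dn 0 (-1) omega)])^-1
  else 0.

Definition Psi (v : R) (x : int) (w : R) : R :=
  expect_on
    (fun omega => let t := time_val (tau_dn x (-1) omega) in
                  v ^+ t * w ^ (- walk x t omega))
    [set omega | isSome (tau_dn x (-1) omega)].

(* The constant a >= 0 for which Z_v(0, w) = 1; the default 0 of xget is
   irrelevant, because W_v(0) = 1/p0 > 0 and 0 <= Psi_v(0, w) <= 1 when
   p0 > 0 and v, w are in (0, 1]. *)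
Definition alpha (p0 v w : R) : R :=
  xget 0 [set a : R | 0 <= a /\ Psi v 0 w + a * W p0 v 0 = 1].

Definition Z (p0 v : R) (x : int) (w : R) : R :=
  Psi v x w + alpha p0 v w * W p0 v x.

(* R_*(n), an integer; the infimum over m <= n is a finite minimum. *)
Definition injections (x : int) (n : nat) (omega : T) : int :=
  Num.max (- \big[Num.min/walk x 0 omega]_(m < n.+1) walk x m omega) 0.

Fixpoint reflected (x : int) (n : nat) (omega : T) : int :=
  if n is k.+1 then Num.max (reflected x k omega + 1 - (C k omega)%:Z) 0
  else Num.max x 0.

Definition rtau_up (x b : int) (omega : T) : option nat :=
  first_time (fun n => b <= reflected x n omega).

End Walk.

(* Main.v *)
Require Import Defs.
From HB Require Import structures.
From mathcomp Require Import all_boot all_order all_algebra.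
From mathcomp Require Import all_classical all_reals all_analysis.
From mathcomp Require Import measurable_realfun zify ring.

Set Implicit Arguments.
Unset Strict Implicit.
Unset Printing Implicit Defensive.

Import Order.TTheory GRing.Theory Num.Theory.
Local Open Scope classical_set_scope.
Local Open Scope ring_scope.

(** Everything rests on conditioning on the first claim and on a uniqueness
    argument. Say that h is harmonic on [0, N) when
        h(x) = v * sum_k p_k h(x + 1 - k)      for 0 <= x < N.
    Since the walk climbs by at most 1 per step and p_0 > 0, this equation
    expresses h(x + 1) through the values of h up to x, so a harmonic function
    is determined up to N by its values on the nonpositive integers
    ([harmonic_unique]).

    The quantities in play are all discounted payoffs collected at a first
    passage time, started from x, and [value_harmonic] shows that they are
    harmonic as long as x is not yet in the stopping set:
    - f(x), the expectation to be computed, on [0, b);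
    - Psi_v(x, w), on [0, N) for every N;
    - g_y(x) = E_x(v^tau_y^+; tau_y^+ < tau_{-1}^-), on [0, y).

    For 0 <= x <= y the functions g_x(0) g_y and g_y(0) g_x are harmonic on
    [0, x) and agree on the nonpositive integers, hence also at x:
    g_y(x) g_x(0) = g_y(0). As W_v(x) = 1 / (p_0 g_x(0)), the scale function is
    on (-oo, y] a constant multiple of g_y, so it is itself harmonic
    ([W_harmonic]), and so is Z_v(., w) = Psi_v(., w) + alpha W_v
    ([Z_harmonic]).

    Finally Z_v(x, w) = w^(-x) for x <= 0, by the choice of alpha at x = 0.
    Below 0 the initial injection -x factors out: f(x) = w^(-x) f(0). By
    uniqueness f = f(0) Z_v(., w) up to b, and f(b) = 1 gives
    f(0) = 1 / Z_v(b, w).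

    The first-step equation itself ([first_step]) is proved for functionals of
    finitely many claims, where the expectation is an iterated sum, and then
    for countable sums of them. *)

(** * First times *)

Lemma first_timeP (A : pred nat) n :
  first_time A = Some n <-> A n /\ (forall m, (m < n)%N -> ~~ A m).
Proof.
rewrite /first_time; case: pselect => [exA|nA]; last first.
  by split=> // -[An _]; case: nA; exists n.
case: ex_minnP => k Ak kmin; split => [[<-]|[An nmin]].
  by split=> // m mk; apply/negP => /kmin; rewrite leqNgt mk.
congr Some; apply/eqP; rewrite eqn_leq kmin//= leqNgt.
by apply/negP => /nmin; rewrite Ak.
Qed.

Lemma first_time_NoneP (A : pred nat) :
  first_time A = None <-> (forall n, ~~ A n).
Proof.
rewrite /first_time; case: pselect => [exA|nA]; split => //.
- by move=> noA; case: (exA) => n An; move: (noA n); rewrite An.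
- by move=> _ n; apply/negP => An; apply: nA; exists n.
Qed.

Lemma first_time0 (A : pred nat) : A 0%N -> first_time A = Some 0%N.
Proof. by move=> A0; apply/first_timeP. Qed.

Lemma first_time_shift (A B : pred nat) :
  ~~ A 0%N -> (forall n, A n.+1 = B n) ->
  first_time A = omap S (first_time B).
Proof.
move=> A0 AB; case eB : (first_time B) => [n|] /=.
  have [Bn nB] := (first_timeP B n).1 eB.
  by apply/first_timeP; rewrite AB; split=> // -[|m] //; rewrite ltnS AB => /nB.
apply/first_time_NoneP => -[//|n]; rewrite AB.
by move: n; exact/first_time_NoneP.
Qed.

(** Strict precedence over a first time that need not have come by time n is
    decided by time n, which makes the two-sided exit payoff adapted. *)
Lemma before_Some_first_time n (A : pred nat) :
  before (Some n) (first_time A) = all (fun m => ~~ A m) (iota 0 n.+1).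
Proof.
apply/idP/allP => [|noA].
  case eA : (first_time A) => [k|] => [nk m|_ m _]; last first.
    by move: m; exact/first_time_NoneP.
  rewrite mem_iota add0n ltnS => /andP[_ mn].
  by apply: ((first_timeP A k).1 eA).2; exact: leq_ltn_trans mn nk.
case eA : (first_time A) => [k|//].
rewrite /= ltnNge; apply/negP => kn.
have := noA k; rewrite mem_iota add0n ltnS => /(_ kn).
by rewrite ((first_timeP A k).1 eA).1.
Qed.

(** * Functions harmonic for the discounted walk *)

Section Harmonic.
Context (R : realType) (p : nat -> R) (v : R).

Definition harmonic (N : int) (h : int -> R) : Prop :=
  forall x : int, 0 <= x -> x < N ->
    (h x)%:E = (v%:E * \sum_(0 <= k <oo) (p k)%:E * (h (x + 1 - k%:Z))%:E)%E.

(** Only arguments up to N occur in the equations. *)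
Lemma eq_harmonic N (h1 h2 : int -> R) :
  (forall x, x <= N -> h1 x = h2 x) -> harmonic N h1 -> harmonic N h2.
Proof.
move=> e H x x0 xN; rewrite -e ?ltW// H//; congr (_ * _)%E.
by apply: eq_eseriesr => k _; rewrite e//; lia.
Qed.

Hypotheses (p_ge0 : forall k, 0 <= p k) (p0_gt0 : 0 < p 0%N) (v_gt0 : 0 < v).

Lemma harmonicD N (h1 h2 : int -> R) :
  (forall x, 0 <= h1 x) -> (forall x, 0 <= h2 x) ->
  harmonic N h1 -> harmonic N h2 -> harmonic N (fun x => h1 x + h2 x).
Proof.
move=> h10 h20 H1 H2 x x0 xN; rewrite EFinD H1// H2//.
rewrite -ge0_muleDr; try by apply: nneseries_ge0 => k _ _; rewrite mule_ge0 ?lee_fin.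
rewrite -nneseriesD; try by move=> k _ _; rewrite mule_ge0 ?lee_fin.
congr (_ * _)%E; apply: eq_eseriesr => k _.
by rewrite EFinD ge0_muleDr ?lee_fin.
Qed.

Lemma harmonicZ N (a : R) (h : int -> R) :
  (forall x, 0 <= h x) -> harmonic N h -> harmonic N (fun x => a * h x).
Proof.
move=> h0 H x x0 xN; rewrite EFinM H// muleCA -nneseriesZl; last first.
  by move=> k _; rewrite mule_ge0 ?lee_fin.
by congr (_ * _)%E; apply: eq_eseriesr => k _; rewrite EFinM muleCA.
Qed.

(** The term k = 0 is the only one that looks above x, and its coefficient
    v p_0 is nonzero: the harmonic equation at x can be solved for h(x + 1).
    The remaining terms of the series have a finite sum because h(x) is finite,
    so they cancel between the two functions. *)
Lemma harmonic_unique N (h1 h2 : int -> R) :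
  (forall x, 0 <= h1 x) -> (forall x, 0 <= h2 x) ->
  harmonic N h1 -> harmonic N h2 ->
  (forall x, x <= 0 -> h1 x = h2 x) ->
  forall x, x <= N -> h1 x = h2 x.
Proof.
move=> h10 h20 H1 H2 e0.
have e n : (n%:Z <= N) -> forall x, x <= n%:Z -> h1 x = h2 x.
  elim: n => [_ x /e0//|n IH nN x].
  have {}IH : forall x, x <= n%:Z -> h1 x = h2 x by apply: IH; lia.
  rewrite le_eqVlt => /orP[/eqP ->|xn]; last by apply: IH; lia.
  pose tail (h : int -> R) :=
    (\sum_(0 <= k <oo | k != 0%N) (p k)%:E * (h (n%:Z + 1 - k%:Z))%:E)%E.
  have split_ h : (forall x, 0 <= h x) -> harmonic N h ->
      tail h \is a fin_num /\ h n%:Z = v * (p 0%N * h n.+1%:Z + fine (tail h)).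
    move=> h0 H.
    have t0 : (0 <= tail h)%E.
      by apply: nneseries_ge0 => k _ _; rewrite mule_ge0 ?lee_fin.
    have /= := H n%:Z isT ltac:(lia).
    rewrite (@nneseriesD1 _ _ 0%N)//=; last first.
      by move=> k _; rewrite mule_ge0 ?lee_fin.
    rewrite -/(tail h) subr0 (_ : n%:Z + 1 = n.+1%:Z); last by lia.
    have : (tail h < +oo \/ tail h = +oo)%E.
      by case: (tail h) => [r| |]; [left; rewrite ltry|right|left].
    case=> [tfin|->]; last by rewrite addey// gt0_muley// lte_fin.
    have tf : tail h \is a fin_num by rewrite ge0_fin_numE.
    rewrite -{1}(fineK tf) -(EFinM (p 0%N)) -EFinD -EFinM => -[eh]; split=> //.
  have [_ e1] := split_ h1 h10 H1; have [_ e2] := split_ h2 h20 H2.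
  have te : tail h1 = tail h2.
    by apply: eq_eseriesr => -[//|k] _; rewrite IH//; lia.
  move: e1; rewrite (IH _ (lexx _)) e2 te => /(mulfI (lt0r_neq0 v_gt0)) /addIr.
  by move=> /(mulfI (lt0r_neq0 p0_gt0)).
move=> x xN; have [/e0//|x0] := leP x 0.
by apply: (e `|x|%N); lia.
Qed.

End Harmonic.

(** * The walk along a sequence of claims *)

Definition claim_cons (k : nat) (c : nat -> nat) : nat -> nat :=
  fun i => if i is j.+1 then c j else k.

Definition cylinder (n : nat) (V : Type) (F : (nat -> nat) -> V) : Prop :=
  forall c c', (forall i, (i < n)%N -> c i = c' i) -> F c = F c'.

Lemma cylinder_cons n (V : Type) (F : (nat -> nat) -> V) k :
  cylinder n.+1 F -> cylinder n (F \o claim_cons k).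
Proof. by move=> cF c c' cc'; apply: cF => -[|i]//= /cc'. Qed.

Lemma cylinder_le m n (V : Type) (F : (nat -> nat) -> V) :
  (m <= n)%N -> cylinder m F -> cylinder n F.
Proof.
by move=> mn cF c c' cc'; apply: cF => i im; apply: cc'; exact: leq_trans mn.
Qed.

(** The processes are redefined as functions of the sequence of claims, so that
    they can be evaluated on a sequence whose first claim has been fixed. *)
Definition walk_of (c : nat -> nat) (x : int) (n : nat) : int :=
  x + n%:Z - \sum_(i < n) (c i)%:Z.

Definition injections_of (c : nat -> nat) (x : int) (n : nat) : int :=
  Num.max (- \big[Num.min/walk_of c x 0]_(m < n.+1) walk_of c x m) 0.

Fixpoint reflected_of (c : nat -> nat) (x : int) (n : nat) : int :=
  if n is k.+1 then Num.max (reflected_of c x k + 1 - (c k)%:Z) 0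
  else Num.max x 0.

Lemma walk_of0 c x : walk_of c x 0 = x.
Proof. by rewrite /walk_of big_ord0 subr0 addr0. Qed.

Lemma walk_of_shift c x n : walk_of c x n = walk_of c 0 n + x.
Proof. by rewrite /walk_of; lia. Qed.

Lemma walk_of_cons k c x n :
  walk_of (claim_cons k c) x n.+1 = walk_of c (x + 1 - k%:Z) n.
Proof.
rewrite /walk_of big_ord_recl /=.
under eq_bigr do rewrite /= add0n.
by lia.
Qed.

Lemma cylinder_walk_of x m n : (m <= n)%N -> cylinder n (fun c => walk_of c x m).
Proof.
move=> mn c c' cc'; rewrite /walk_of; congr (_ - _); apply: eq_bigr => i _.
by rewrite cc'//; exact: leq_trans (ltn_ord i) mn.
Qed.

(** The injections are handled through their upper bounds, which turn the
    running minimum into pointwise bounds on the walk. *)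
Lemma injections_ofP c x n z :
  reflect (0 <= z /\ forall m, (m <= n)%N -> - z <= walk_of c x m)
          (injections_of c x n <= z).
Proof.
rewrite /injections_of ge_max lerNl; apply: (iffP andP).
  move=> [/bigmin_geP[_ h] z0]; split=> // m mn.
  exact: (h (Ordinal (mn : (m < n.+1)%N))).
move=> [z0 h]; split=> //; apply/bigmin_geP; split=> [|i _]; apply: h => //.
by rewrite -ltnS.
Qed.

Lemma injections_of_ge0 c x n : 0 <= injections_of c x n.
Proof. by rewrite /injections_of le_max lexx orbT. Qed.

Lemma eq_le_bounds (a b : int) : (forall z, (a <= z) = (b <= z)) -> a = b.
Proof. by move=> e; apply/eqP; rewrite eq_le e lexx -e lexx. Qed.

Lemma cylinder_injections_of x n : cylinder n (fun c => injections_of c x n).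
Proof.
move=> c c' cc'; apply: eq_le_bounds => z.
have we m : (m <= n)%N -> walk_of c x m = walk_of c' x m.
  by move=> mn; exact: (cylinder_walk_of x mn).
apply/injections_ofP/injections_ofP => -[z0 h]; split=> // m mn.
  by rewrite -we ?h.
by rewrite we ?h.
Qed.

(** From x >= 0 the position at time 0 does not affect the minimum with 0, so
    the injections restart after the first claim. *)
Lemma injections_of_cons k c x n : 0 <= x ->
  injections_of (claim_cons k c) x n.+1 = injections_of c (x + 1 - k%:Z) n.
Proof.
move=> x0; apply: eq_le_bounds => z.
apply/injections_ofP/injections_ofP => -[z0 h]; split=> //.
  by move=> m mn; rewrite -walk_of_cons; exact: h.
by move=> [_|m mn]; [rewrite walk_of0; lia|rewrite walk_of_cons; exact: h].
Qed.

Lemma injections_of_neg c x n : x <= 0 ->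
  injections_of c x n = injections_of c 0 n - x.
Proof.
move=> x0; apply: eq_le_bounds => z; rewrite lerBlDr.
apply/injections_ofP/injections_ofP => -[z0 h].
  split=> [|m mn]; first by have := h 0%N isT; rewrite walk_of0; lia.
  by have := h m mn; rewrite [walk_of c x m]walk_of_shift; lia.
split=> [|m mn]; first by lia.
by have := h m mn; rewrite [walk_of c x m]walk_of_shift; lia.
Qed.

Lemma cylinder_reflected_of x n : cylinder n (fun c => reflected_of c x n).
Proof.
elim: n => [|n IH] c c' cc' //=; rewrite (IH c c') ?cc'// => i ni.
by apply: cc'; exact: ltnW.
Qed.

Lemma reflected_of_cons k c x n : 0 <= x ->
  reflected_of (claim_cons k c) x n.+1 = reflected_of c (x + 1 - k%:Z) n.
Proof.
by move=> x0; elim: n => [|n IH] /=; [rewrite (max_l x0)|rewrite -IH].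
Qed.

Lemma reflected_of_neg c x n : x <= 0 -> reflected_of c x n = reflected_of c 0 n.
Proof. by move=> x0; elim: n => [|n IH] /=; [rewrite (max_r x0) maxxx|rewrite IH]. Qed.

Lemma exprz_unit_interval (R : realType) (w : R) (z : int) :
  0 < w <= 1 -> 0 <= z -> 0 <= w ^ z <= 1.
Proof.
by move=> /andP[w0 w1]; case: z => // n _; rewrite -exprnP exprn_ge0 ?exprn_ile1// ltW.
Qed.

(** * Conditioning on the first claim *)

Section FirstStep.
Context (d : measure_display) (T : measurableType d) (R : realType).
Context (P : probability T R) (p : nat -> R) (C : nat -> {RV P >-> nat}).
Hypothesis hp : is_pmf p.
Hypothesis C_law : forall i k, P (C i @^-1` [set k]) = (p k)%:E.
Hypothesis C_indep : mutually_independent C.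

Let p_ge0 k : 0 <= p k. Proof. by case: hp. Qed.

(** The expectation of a functional of n independent claims with law p, written
    as a sum over the successive claims. A functional of no claims is constant,
    so the sequence at which it is evaluated is arbitrary. *)
Fixpoint iterated_sum (n : nat) (F : (nat -> nat) -> \bar R) : \bar R :=
  if n is m.+1
  then (\sum_(0 <= k <oo) (p k)%:E * iterated_sum m (F \o claim_cons k))%E
  else F (fun=> 0%N).

Lemma iterated_sum_ge0 n F : (forall c, 0 <= F c)%E -> (0 <= iterated_sum n F)%E.
Proof.
elim: n F => [|n IH] F F0 //=.
by apply: nneseries_ge0 => k _ _; rewrite mule_ge0 ?lee_fin//; apply: IH => c /=.
Qed.

Definition prefix_event (s : seq nat) : set T :=
  [set omega | forall i, (i < size s)%N -> C i omega = nth 0%N s i].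

Lemma prefix_event_rcons s k :
  prefix_event (rcons s k) = prefix_event s `&` C (size s) @^-1` [set k].
Proof.
apply/seteqP; split => omega /=.
- move=> h; split=> [i si|].
    by rewrite h ?size_rcons ?ltnS 1?ltnW// nth_rcons si.
  by rewrite h ?size_rcons// nth_rcons ltnn eqxx.
- move=> [h hk] i; rewrite size_rcons ltnS leq_eqVlt => /orP[/eqP->|si].
    by rewrite nth_rcons ltnn eqxx.
  by rewrite nth_rcons si h.
Qed.

Lemma prefix_eventE s :
  prefix_event s =
  \bigcap_(j in [set` iota 0 (size s)]) (C j @^-1` [set nth 0%N s j]).
Proof.
apply/seteqP; split => omega /= h i.
- by rewrite /= mem_iota => /andP[_ si]; apply: h.
- by move=> si; apply: h; rewrite /= mem_iota.
Qed.

Lemma measurable_prefix_event s : measurable (prefix_event s).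
Proof.
by rewrite prefix_eventE; apply: bigcap_measurableType => j _; apply: measurable_funPTI.
Qed.

Lemma prefix_event_nil : prefix_event [::] = setT.
Proof. by apply/seteqP; split. Qed.

Lemma prob_prefix_event s : P (prefix_event s) = (\prod_(k <- s) p k)%:E.
Proof.
rewrite prefix_eventE C_indep ?iota_uniq//.
rewrite (eq_bigr (fun j => (p (nth 0%N s j))%:E)); last by move=> j _; exact: C_law.
by rewrite prodEFin [in RHS](big_nth 0%N) /index_iota subn0.
Qed.

Lemma prefix_event_bigcup s :
  prefix_event s = \bigcup_k prefix_event (rcons s k).
Proof.
apply/seteqP; split => omega.
- by move=> h; exists (C (size s) omega) => //; rewrite prefix_event_rcons.
- by move=> [k _]; rewrite prefix_event_rcons => -[].
Qed.

Definition claims_from (m : nat) (omega : T) : nat -> nat :=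
  fun i => C (m + i)%N omega.

(** Independence and identical distribution enter here: given the claims in s,
    the following ones behave like a fresh sequence. Splitting according to the
    next claim reduces n + 1 to n, provided that the prefix s is arbitrary;
    measurability is obtained along the same partition. *)
Lemma cylinder_integral n s (F : (nat -> nat) -> \bar R) :
  (forall c, 0 <= F c)%E -> cylinder n F ->
  measurable_fun (prefix_event s) (F \o claims_from (size s)) /\
  (\int[P]_(omega in prefix_event s) F (claims_from (size s) omega)
    = (\prod_(k <- s) p k)%:E * iterated_sum n F)%E.
Proof.
elim: n s F => [|n IH] s F F0 cF.
  have Fcst c : F c = F (fun=> 0%N) by apply: cF.
  split.
    apply: (@eq_measurable_fun _ _ _ _ _ (cst (F (fun=> 0%N)))); last first.
      exact: measurable_cst.
    by move=> omega _ /=; rewrite Fcst.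
  under eq_integral do rewrite Fcst.
  rewrite /= integral_cst; last exact: measurable_prefix_event.
  by rewrite muleC; congr (_ * _)%E; exact: prob_prefix_event.
have FE k : {in prefix_event (rcons s k),
    (F \o claim_cons k) \o claims_from (size (rcons s k)) =1
    (F \o claims_from (size s))}.
  move=> omega; rewrite inE prefix_event_rcons => -[_ /= hk].
  apply: cF => -[|i] _ /=; first by rewrite /claims_from addn0.
  by rewrite /claims_from size_rcons addnS addSn.
have mk k := IH (rcons s k) _ (fun c => F0 (claim_cons k c)) (cylinder_cons k cF).
have mF : measurable_fun (prefix_event s) (F \o claims_from (size s)).
  rewrite prefix_event_bigcup; apply/measurable_fun_bigcup => k.
    exact: measurable_prefix_event.
  by apply: (eq_measurable_fun _ (FE k)); exact: (mk k).1.
split=> //.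
rewrite {1}prefix_event_bigcup ge0_integral_bigcup//.
- rewrite -nneseriesZl; last first.
    by move=> k _; rewrite mule_ge0 ?lee_fin//; apply: iterated_sum_ge0 => c /=.
  apply: eq_eseriesr => k _.
  rewrite -(eq_integral _ _ (FE k)) (mk k).2.
  by rewrite -cats1 big_cat big_seq1/= EFinM muleA.
- by move=> k; exact: measurable_prefix_event.
- by rewrite -prefix_event_bigcup.
- apply/trivIsetP => i j _ _ ij; rewrite -subset0 => omega [].
  rewrite !prefix_event_rcons => -[_ /= hi] [_ /= hj].
  by move/eqP: ij; rewrite -hi -hj.
Qed.

Local Notation claims := (claims_from 0).

Lemma cylinder_measurable n (F : (nat -> nat) -> \bar R) :
  (forall c, 0 <= F c)%E -> cylinder n F ->
  measurable_fun setT (F \o claims).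
Proof.
by move=> F0 cF; have [+ _] := cylinder_integral [::] F0 cF; rewrite prefix_event_nil.
Qed.

(** Both sides are the same iterated sum, once F is viewed as depending on one
    claim more than necessary, so that a first claim can be split off even
    when n = 0. *)
Lemma cylinder_first_step n (F : (nat -> nat) -> \bar R) :
  (forall c, 0 <= F c)%E -> cylinder n F ->
  (\int[P]_omega F (claims omega) =
   \sum_(0 <= k <oo) (p k)%:E * \int[P]_omega F (claim_cons k (claims omega)))%E.
Proof.
move=> F0 cF; have cF' := cylinder_le (leqnSn n) cF.
have [_] := cylinder_integral [::] F0 cF'.
rewrite prefix_event_nil big_nil mul1e => ->.
apply: eq_eseriesr => k _; congr (_ * _)%E.
have [_] := cylinder_integral [::] (fun c => F0 (claim_cons k c)) (cylinder_cons k cF').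
by rewrite prefix_event_nil big_nil mul1e => ->.
Qed.

(** A payoff collected at an unbounded random time depends on infinitely many
    claims, but it is the sum over n of its restrictions to the event that the
    time equals n; nonnegativity allows the interchange of sums. *)
Lemma first_step (F : (nat -> nat) -> \bar R) (Fn : nat -> (nat -> nat) -> \bar R) :
  (forall n c, 0 <= Fn n c)%E -> (forall n, cylinder n (Fn n)) ->
  (forall c, F c = \sum_(0 <= n <oo) Fn n c)%E ->
  (\int[P]_omega F (claims omega) =
   \sum_(0 <= k <oo) (p k)%:E * \int[P]_omega F (claim_cons k (claims omega)))%E.
Proof.
move=> F0 cF FE.
under eq_integral do rewrite FE.
have cFk k n : cylinder n (Fn n \o claim_cons k).
  by apply: cylinder_cons; exact: cylinder_le (cF n).
rewrite integral_nneseries//; last by move=> n; exact: (cylinder_measurable (F0 n) (cF n)).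
under eq_eseriesr do rewrite (cylinder_first_step (F0 _) (cF _)).
rewrite nneseries_interchange; last first.
  by move=> i k; rewrite mule_ge0 ?lee_fin ?integral_ge0.
apply: eq_eseriesr => k _.
rewrite nneseriesZl; last by move=> i _; rewrite integral_ge0.
congr (_ * _)%E.
under [in RHS]eq_integral do rewrite FE.
rewrite integral_nneseries// => n.
exact: (cylinder_measurable (fun c => F0 n (claim_cons k c)) (cFk k n)).
Qed.

(** * Payoffs collected at a first time *)

Lemma integral_cst_prob (a : R) : (\int[P]_omega a%:E = a%:E)%E.
Proof.
rewrite integral_cst// -[RHS]mule1; congr (_ * _)%E; exact: probability_setT.
Qed.

Section Stopped.
Context (A : nat -> (nat -> nat) -> bool) (G : nat -> (nat -> nat) -> R).

Definition stopped_payoff (c : nat -> nat) : R :=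
  if first_time (A ^~ c) is Some n then G n c else 0.

(** The last condition only concerns collected rewards: the discount w^(-X_n) of
    the deficit may exceed 1 as long as the walk has not been ruined. *)
Definition stoppable : Prop :=
  [/\ forall n, cylinder n (A n), forall n, cylinder n (G n)
    & forall n c, A n c -> 0 <= G n c <= 1].

Definition payoff_at (n : nat) (c : nat -> nat) : \bar R :=
  (if first_time (A ^~ c) == Some n then G n c else 0)%:E.

Hypothesis AG : stoppable.

Lemma stopped_payoff_bounds c : 0 <= stopped_payoff c <= 1.
Proof.
rewrite /stopped_payoff; case e : (first_time _) => [n|]; last by rewrite lexx ler01.
by case: AG => _ _; apply; exact: ((first_timeP _ _).1 e).1.
Qed.

Lemma stopped_payoff_ge0 c : (0 <= (stopped_payoff c)%:E)%E.
Proof. by rewrite lee_fin; case/andP: (stopped_payoff_bounds c). Qed.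

Lemma payoff_at_ge0 n c : (0 <= payoff_at n c)%E.
Proof.
rewrite /payoff_at lee_fin; case: eqP => // e.
by case: AG => _ _ /(_ n c); case/(_ ((first_timeP _ _).1 e).1)/andP.
Qed.

Lemma cylinder_payoff_at n : cylinder n (payoff_at n).
Proof.
case: AG => cA cG _ c c' cc'; rewrite /payoff_at (cG n c c' cc').
have AE m : (m <= n)%N -> A m c = A m c'.
  by move=> mn; apply: cA => i im; apply: cc'; exact: leq_trans mn.
suff -> : (first_time (A ^~ c) == Some n) = (first_time (A ^~ c') == Some n) by [].
apply/eqP/eqP => /first_timeP[An nA]; apply/first_timeP.
  by split=> [|m mn]; rewrite -AE// ?(ltnW mn)// nA.
by split=> [|m mn]; rewrite AE// ?(ltnW mn)// nA.
Qed.

Lemma stopped_payoff_series c :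
  ((stopped_payoff c)%:E = \sum_(0 <= n <oo) payoff_at n c)%E.
Proof.
rewrite /stopped_payoff; case e : (first_time _) => [n|]; last first.
  by rewrite eseries0// => i _ _; rewrite /payoff_at e.
rewrite (@nneseriesD1 _ _ n)//; last by move=> k _; exact: payoff_at_ge0.
rewrite {1}/payoff_at e eqxx eseries0 ?adde0// => i _ ni.
by rewrite /payoff_at e; case: ifP => // /eqP[nE]; rewrite nE eqxx in ni.
Qed.

Lemma measurable_stopped_payoff :
  measurable_fun setT (fun omega => (stopped_payoff (claims omega))%:E).
Proof.
under eq_fun do rewrite stopped_payoff_series.
apply: (@ge0_emeasurable_sum _ _ _ _ (fun n => payoff_at n \o claims) xpredT) => //.
  by move=> n omega _ _; exact: payoff_at_ge0.
by move=> n _; exact: (cylinder_measurable (payoff_at_ge0 n) (@cylinder_payoff_at n)).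
Qed.

Definition value : R :=
  fine (\int[P]_omega (stopped_payoff (claims omega))%:E)%E.

Lemma integral_stopped_payoff_bounds :
  (0 <= \int[P]_omega (stopped_payoff (claims omega))%:E <= 1)%E.
Proof.
apply/andP; split.
  by apply: integral_ge0 => omega _; exact: stopped_payoff_ge0.
rewrite -(integral_cst_prob 1).
apply: ge0_le_integral => //.
- by move=> omega _; exact: stopped_payoff_ge0.
- exact: measurable_stopped_payoff.
- by move=> omega _; rewrite lee_fin; case/andP: (stopped_payoff_bounds (claims omega)).
Qed.

Lemma valueE :
  (value%:E = \int[P]_omega (stopped_payoff (claims omega))%:E)%E.
Proof.
rewrite /value fineK// ge0_fin_numE; case/andP: integral_stopped_payoff_bounds => //.
by move=> _ /le_lt_trans; apply; rewrite ltry.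
Qed.

Lemma value_bounds : 0 <= value <= 1.
Proof. by have := integral_stopped_payoff_bounds; rewrite -valueE !lee_fin. Qed.

Lemma value_ge0 : 0 <= value.
Proof. by case/andP: value_bounds. Qed.

Lemma value_cst a : (forall c, stopped_payoff c = a) -> value = a.
Proof.
move=> ea; rewrite /value; under eq_integral do rewrite ea.
by rewrite integral_cst_prob.
Qed.

End Stopped.

Lemma expect_on_value A G (Y : T -> R) (E : set T) :
  (forall omega, Y omega * \1_E omega = stopped_payoff A G (claims omega)) ->
  expect_on P Y E = value A G.
Proof.
move=> e; rewrite /expect_on /value expectation.unlock; congr fine.
by apply: eq_integral => omega _; rewrite e.
Qed.

(** When the process cannot stop at time 0, fixing the first claim k shifts the
    first time by 1, costs one discount factor v, and restarts from x + 1 - k. *)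
Lemma value_harmonic (A : int -> nat -> (nat -> nat) -> bool)
    (G : int -> nat -> (nat -> nat) -> R) (v : R) (N : int) :
  0 <= v ->
  (forall x, stoppable (A x) (G x)) ->
  (forall x, 0 <= x -> x < N -> forall c, ~~ A x 0%N c) ->
  (forall x k n c, 0 <= x -> x < N -> A x n.+1 (claim_cons k c) = A (x + 1 - k%:Z) n c) ->
  (forall x k n c, 0 <= x -> x < N -> G x n.+1 (claim_cons k c) = v * G (x + 1 - k%:Z) n c) ->
  harmonic p v N (fun x => value (A x) (G x)).
Proof.
move=> v0 AG A0 AS GS x x0 xN; rewrite valueE//.
have step k c : stopped_payoff (A x) (G x) (claim_cons k c)
    = v * stopped_payoff (A (x + 1 - k%:Z)) (G (x + 1 - k%:Z)) c.
  rewrite /stopped_payoff.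
  rewrite (@first_time_shift _ (A (x + 1 - k%:Z) ^~ c)) ?A0//; last first.
    by move=> n; rewrite AS.
  by case: (first_time _) => [n|] /=; rewrite ?GS// mulr0.
rewrite (@first_step (EFin \o stopped_payoff (A x) (G x)) (payoff_at (A x) (G x))); last first.
- by move=> c; rewrite /= stopped_payoff_series.
- by move=> n; exact: cylinder_payoff_at.
- by move=> n c; exact: payoff_at_ge0.
have vb y := value_bounds (AG y).
rewrite -nneseriesZl; last first.
  by move=> k _; rewrite mule_ge0// lee_fin//; case/andP: (vb (x + 1 - k%:Z)).
apply: eq_eseriesr => k _; rewrite muleCA; congr (_ * _)%E.
rewrite valueE// -ge0_integralZl_EFin//.
- by apply: eq_integral => omega _ /=; rewrite step EFinM.
- by move=> omega _; exact: stopped_payoff_ge0.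
- exact: measurable_stopped_payoff.
Qed.

(** * Reflected, ruin and two-sided exit values *)

Context (v w : R).
Hypotheses (hp0 : 0 < p 0%N) (hv : 0 < v <= 1) (hw : 0 < w <= 1).

Let v_gt0 : 0 < v. Proof. by case/andP: hv. Qed.
Let v_ge0 : 0 <= v. Proof. exact: ltW. Qed.
Let w_gt0 : 0 < w. Proof. by case/andP: hw. Qed.

Let vn_bounds n : 0 <= v ^+ n <= 1.
Proof. by rewrite exprnP exprz_unit_interval. Qed.

Definition reflected_up (b : int) (x : int) (n : nat) (c : nat -> nat) : bool :=
  b <= reflected_of c x n.
Definition reflected_reward (x : int) (n : nat) (c : nat -> nat) : R :=
  v ^+ n * w ^ injections_of c x n.
Definition reflected_value (b x : int) : R :=
  value (reflected_up b x) (reflected_reward x).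

Definition ruined (x : int) (n : nat) (c : nat -> nat) : bool :=
  walk_of c x n <= -1.
Definition ruin_reward (x : int) (n : nat) (c : nat -> nat) : R :=
  v ^+ n * w ^ (- walk_of c x n).
Definition ruin_value (x : int) : R := value (ruined x) (ruin_reward x).

Definition passed_up (y : int) (x : int) (n : nat) (c : nat -> nat) : bool :=
  y <= walk_of c x n.
(** The reward behind g_y(x) = E_x(v^tau_y^+; tau_y^+ < tau_{-1}^-). It carries
    the event: it vanishes on ruin before or at time n. *)
Definition exit_reward (x : int) (n : nat) (c : nat -> nat) : R :=
  v ^+ n * (all (fun m => ~~ ruined x m c) (iota 0 n.+1))%:R.
Definition exit_value (y x : int) : R := value (passed_up y x) (exit_reward x).

Let mul_bounds (a e : R) : 0 <= a <= 1 -> 0 <= e <= 1 -> 0 <= a * e <= 1.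
Proof.
by move=> /andP[a0 a1] /andP[e0 e1]; rewrite mulr_ge0// mulr_ile1.
Qed.

Lemma reflected_stoppable b x : stoppable (reflected_up b x) (reflected_reward x).
Proof.
split.
- by move=> n c c' cc'; rewrite /reflected_up (cylinder_reflected_of x cc').
- by move=> n c c' cc'; rewrite /reflected_reward (cylinder_injections_of x cc').
- move=> n c _; rewrite mul_bounds// exprz_unit_interval//.
  exact: injections_of_ge0.
Qed.

Lemma ruin_stoppable x : stoppable (ruined x) (ruin_reward x).
Proof.
split.
- by move=> n c c' cc'; rewrite /ruined (cylinder_walk_of x (leqnn n) cc').
- by move=> n c c' cc'; rewrite /ruin_reward (cylinder_walk_of x (leqnn n) cc').
- move=> n c; rewrite /ruined => h; rewrite mul_bounds// exprz_unit_interval//.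
  by lia.
Qed.

Lemma exit_stoppable y x : stoppable (passed_up y x) (exit_reward x).
Proof.
split.
- by move=> n c c' cc'; rewrite /passed_up (cylinder_walk_of x (leqnn n) cc').
- move=> n c c' cc'; rewrite /exit_reward; congr (_ * (nat_of_bool _)%:R).
  apply: eq_in_all => m; rewrite mem_iota add0n ltnS => /andP[_ mn].
  by rewrite /ruined (cylinder_walk_of x mn cc').
- by move=> n c _; rewrite mul_bounds//; case: (all _ _); rewrite ?lexx ler01.
Qed.

Lemma reflected_harmonic b : harmonic p v b (reflected_value b).
Proof.
apply: value_harmonic => //.
- by move=> x; exact: reflected_stoppable.
- by move=> x x0 xb c; rewrite /reflected_up /= max_l// -ltNge.
- by move=> x k n c x0 xb; rewrite /reflected_up reflected_of_cons.
- by move=> x k n c x0 xb; rewrite /reflected_reward injections_of_cons// exprS mulrA.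
Qed.

Lemma ruin_harmonic N : harmonic p v N ruin_value.
Proof.
apply: value_harmonic => //.
- by move=> x; exact: ruin_stoppable.
- by move=> x x0 xb c; rewrite /ruined walk_of0; lia.
- by move=> x k n c x0 xb; rewrite /ruined walk_of_cons.
- by move=> x k n c x0 xb; rewrite /ruin_reward walk_of_cons// exprS mulrA.
Qed.

Lemma exit_harmonic y : harmonic p v y (exit_value y).
Proof.
apply: value_harmonic => //.
- by move=> x; exact: exit_stoppable.
- by move=> x x0 xb c; rewrite /passed_up walk_of0 -ltNge.
- by move=> x k n c x0 xb; rewrite /passed_up walk_of_cons.
- move=> x k n c x0 xb; rewrite /exit_reward exprS mulrA; congr (_ * (nat_of_bool _)%:R).
  rewrite (iotaD 0 1 n.+1) all_cat (iotaDl 1 0) all_map all_seq1.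
  rewrite {1}/ruined walk_of0 (_ : ~~ _ = true) ?andTb; last by lia.
  by apply: eq_all => m; rewrite /= /ruined walk_of_cons.
Qed.

Lemma reflected_value_ge b x : 0 <= b -> b <= x -> reflected_value b x = 1.
Proof.
move=> b0 bx; apply: value_cst => c.
rewrite /stopped_payoff first_time0; last first.
  by rewrite /reflected_up /= le_max bx.
rewrite /reflected_reward expr0 mul1r (_ : injections_of c x 0 = 0) ?expr0z//.
apply/le_anti; rewrite injections_of_ge0 andbT; apply/injections_ofP; split=> // m.
by rewrite leqn0 => /eqP->; rewrite walk_of0 oppr0; exact: le_trans bx.
Qed.

(** The reflected process does not see a negative starting point, which only
    adds -x to the injections. *)
Lemma reflected_value_neg b x : x <= 0 ->
  reflected_value b x = w ^ (- x) * reflected_value b 0.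
Proof.
move=> x0; have e z := valueE (reflected_stoppable b z).
apply: EFin_inj; rewrite EFinM /reflected_value [LHS]e [X in (_ * X)%E]e.
rewrite -ge0_integralZl_EFin//.
- apply: eq_integral => omega _; rewrite -EFinM; congr (_%:E).
  set c := claims omega.
  rewrite /stopped_payoff (_ : reflected_up b x ^~ c = reflected_up b 0 ^~ c); last first.
    by apply/funext => n; rewrite /reflected_up reflected_of_neg.
  case: (first_time _) => [n|]; last by rewrite mulr0.
  rewrite /reflected_reward injections_of_neg// addrC expfzDr ?gt_eqF// mulrCA.
  by [].
- by move=> omega _; exact/stopped_payoff_ge0/reflected_stoppable.
- exact/measurable_stopped_payoff/reflected_stoppable.
- by rewrite exprz_ge0// ltW.
Qed.

Lemma ruin_value_neg x : x < 0 -> ruin_value x = w ^ (- x).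
Proof.
move=> x0; apply: value_cst => c; rewrite /stopped_payoff first_time0; last first.
  by rewrite /ruined walk_of0; lia.
by rewrite /ruin_reward walk_of0 mul1r.
Qed.

Lemma exit_value_neg y x : x < 0 -> exit_value y x = 0.
Proof.
move=> x0; apply: value_cst => c; rewrite /stopped_payoff.
case: (first_time _) => // n; rewrite /exit_reward /= {1}/ruined walk_of0.
by rewrite (_ : ~~ _ = false) ?mulr0//; lia.
Qed.

Lemma exit_value_diag y : 0 <= y -> exit_value y y = 1.
Proof.
move=> y0; apply: value_cst => c; rewrite /stopped_payoff first_time0; last first.
  by rewrite /passed_up walk_of0.
rewrite /exit_reward /= /ruined walk_of0 mul1r.
by rewrite (_ : ~~ _ = true)//; lia.
Qed.

Lemma exit_value_ge0 y x : 0 <= exit_value y x.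
Proof. exact: value_ge0 (exit_stoppable y x). Qed.

(** * The scale functions *)

(** To exit from 0 at y the walk must pass x, as it climbs by unit steps. The
    identity follows by uniqueness: up to x, both g_x(0) g_y and g_y(0) g_x are
    harmonic and take the same values on the nonpositive integers. *)
Lemma exit_value_mul x y : 0 <= x -> x <= y ->
  exit_value y x * exit_value x 0 = exit_value y 0.
Proof.
move=> x0 xy.
have := @harmonic_unique R p v p_ge0 hp0 v_gt0 x
  (fun z => exit_value x 0 * exit_value y z) (fun z => exit_value y 0 * exit_value x z).
move=> /(_ _ _ _ _ _ x (lexx x)); rewrite exit_value_diag// mulr1 mulrC; apply.
- by move=> z; rewrite mulr_ge0 ?exit_value_ge0.
- by move=> z; rewrite mulr_ge0 ?exit_value_ge0.
- apply: harmonicZ => //; first exact: exit_value_ge0.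
  by move=> z z0 zx; apply: exit_harmonic => //; exact: lt_le_trans zx xy.
- by apply: harmonicZ => //; [exact: exit_value_ge0|exact: exit_harmonic].
- move=> z; rewrite le_eqVlt => /orP[/eqP->|z0]; first by rewrite mulrC.
  by rewrite !(exit_value_neg _ z0) !mulr0.
Qed.

(** If g_y vanished at 0 it would vanish up to y, whereas g_y(y) = 1. *)
Lemma exit_value_gt0 y : 0 <= y -> 0 < exit_value y 0.
Proof.
move=> y0; rewrite lt0r exit_value_ge0 andbT; apply/eqP => e0.
have : exit_value y y = 0.
  apply: (@harmonic_unique R p v p_ge0 hp0 v_gt0 y (exit_value y) (fun=> 0)) => //.
  - exact: exit_value_ge0.
  - exact: exit_harmonic.
  - move=> z _ _; rewrite eseries0 ?mule0// => i _ _.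
    by rewrite mule0.
  - by move=> z; rewrite le_eqVlt => /orP[/eqP->//|z0]; rewrite exit_value_neg.
by rewrite exit_value_diag// => /eqP; rewrite oner_eq0.
Qed.

Lemma W_exit_value y : 0 <= y -> W P C (p 0%N) v y = (p 0%N * exit_value y 0)^-1.
Proof.
move=> y0; rewrite /W y0; congr (_ * _)^-1; apply: expect_on_value => omega.
rewrite /stopped_payoff -/(tau_up C 0 y omega).
rewrite indicE; case e : (tau_up C 0 y omega) => [n|]; last first.
  by rewrite memNset /= ?e// mulr0.
rewrite /exit_reward -before_Some_first_time /=; congr (_ * (nat_of_bool _)%:R).
by apply/idP/idP; rewrite inE /= e.
Qed.

(** The right-hand side involves one fixed target y, whereas W_v(x) is defined
    with the target x: this is what makes W_v harmonic. *)
Lemma W_scaled y x : 0 <= y -> x <= y ->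
  W P C (p 0%N) v x = (p 0%N * exit_value y 0)^-1 * exit_value y x.
Proof.
move=> y0 xy; have [x0|x0] := leP 0 x; last first.
  by rewrite /W [0 <= x]leNgt x0 /= (exit_value_neg y x0) mulr0.
rewrite W_exit_value// -(exit_value_mul x0 xy).
have gx := exit_value_gt0 x0; have : 0 < exit_value y 0 := exit_value_gt0 y0.
rewrite -(exit_value_mul x0 xy) pmulr_lgt0// => gyx.
by field; rewrite !gt_eqF.
Qed.

Lemma W_ge0 x : 0 <= W P C (p 0%N) v x.
Proof.
have [x0|x0] := leP 0 x; last by rewrite /W [0 <= x]leNgt x0.
by rewrite W_exit_value// invr_ge0 mulr_ge0 ?exit_value_ge0// ltW.
Qed.

Lemma W_harmonic y : 0 <= y -> harmonic p v y (W P C (p 0%N) v).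
Proof.
move=> y0.
apply: (@eq_harmonic R p v y (fun x => (p 0%N * exit_value y 0)^-1 * exit_value y x)
  (W P C (p 0%N) v)).
  by move=> x xy; rewrite (W_scaled y0 xy).
by apply: harmonicZ => //; [exact: exit_value_ge0|exact: exit_harmonic].
Qed.

Lemma Psi_ruin_value x : Psi P C v x w = ruin_value x.
Proof.
apply: expect_on_value => omega.
rewrite /stopped_payoff -/(tau_dn C x (-1) omega) indicE.
case e : (tau_dn C x (-1) omega) => [n|]; last by rewrite memNset /= ?e// mulr0.
by rewrite mem_set /= ?e// mulr1.
Qed.

(** Since g_0(0) = 1, W_v(0) = 1 / p_0 and the constant (1 - Psi_v(0, w)) p_0
    works; it is nonnegative because the ruin payoff is at most 1. *)
Lemma alphaP :
  0 <= alpha P C (p 0%N) v w /\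
  ruin_value 0 + alpha P C (p 0%N) v w * W P C (p 0%N) v 0 = 1.
Proof.
rewrite -Psi_ruin_value; apply: (xgetPex 0
  (P := [set a : R | 0 <= a /\ Psi P C v 0 w + a * W P C (p 0%N) v 0 = 1])).
exists ((1 - ruin_value 0) * p 0%N); split.
  have /andP[_ r1] := value_bounds (ruin_stoppable 0).
  by rewrite mulr_ge0 ?subr_ge0// ltW.
rewrite Psi_ruin_value W_exit_value// exit_value_diag// mulr1.
by rewrite mulfK ?gt_eqF// addrC subrK.
Qed.

Lemma ZE x : Z P C (p 0%N) v x w
  = ruin_value x + alpha P C (p 0%N) v w * W P C (p 0%N) v x.
Proof. by rewrite /Z Psi_ruin_value. Qed.

Lemma Z_ge0 x : 0 <= Z P C (p 0%N) v x w.
Proof.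
rewrite ZE addr_ge0 ?(value_ge0 (ruin_stoppable x))//.
by rewrite mulr_ge0 ?W_ge0//; case: alphaP.
Qed.

Lemma Z_harmonic y : 0 <= y -> harmonic p v y (fun x => Z P C (p 0%N) v x w).
Proof.
move=> y0; apply: (@eq_harmonic R p v y
  (fun x => ruin_value x + alpha P C (p 0%N) v w * W P C (p 0%N) v x)
  (fun x => Z P C (p 0%N) v x w)).
  by move=> x _; rewrite ZE.
have [a0 _] := alphaP.
apply: harmonicD => //.
- by move=> x; exact: value_ge0 (ruin_stoppable x).
- by move=> x; rewrite mulr_ge0 ?W_ge0.
- exact: ruin_harmonic.
- by apply: harmonicZ; [exact: p_ge0|exact: W_ge0|exact: W_harmonic].
Qed.

Lemma Z_neg x : x <= 0 -> Z P C (p 0%N) v x w = w ^ (- x).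
Proof.
rewrite ZE le_eqVlt => /orP[/eqP->|x0]; first by case: alphaP.
by rewrite ruin_value_neg// /W [0 <= x]leNgt x0 /= mulr0 addr0.
Qed.

Lemma reflected_value_Z b x : 0 <= b -> x <= b ->
  reflected_value b x = reflected_value b 0 * Z P C (p 0%N) v x w.
Proof.
move=> b0; have r0 z := value_ge0 (reflected_stoppable b z).
apply: (@harmonic_unique R p v p_ge0 hp0 v_gt0 b (reflected_value b)
  (fun z => reflected_value b 0 * Z P C (p 0%N) v z w)) => //.
- by move=> z; rewrite mulr_ge0 ?Z_ge0//; exact: r0.
- exact: reflected_harmonic.
- by apply: harmonicZ; [exact: p_ge0|exact: Z_ge0|exact: Z_harmonic].
- by move=> z z0; rewrite reflected_value_neg// Z_neg// mulrC.
Qed.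

Lemma reflected_claims x n omega :
  reflected C x n omega = reflected_of (claims omega) x n.
Proof. by elim: n => [|n IH] //=; rewrite IH. Qed.

Lemma expect_on_reflected b x :
  expect_on P
    (fun omega => let t := time_val (rtau_up C x b omega) in
                  v ^+ t * w ^ injections C x t omega)
    [set omega | isSome (rtau_up C x b omega)] = reflected_value b x.
Proof.
apply: expect_on_value => omega.
have tauE : rtau_up C x b omega = first_time (reflected_up b x ^~ (claims omega)).
  by congr first_time; apply/funext => n; rewrite reflected_claims.
rewrite /stopped_payoff -tauE indicE.
case e : (rtau_up C x b omega) => [n|]; last by rewrite memNset /= ?e// mulr0.
by rewrite mem_set /= ?e// mulr1.
Qed.

End FirstStep.

Theorem proposition25 (d : measure_display) (T : measurableType d)
    (R : realType) (P : probability T R)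
    (p : nat -> R) (C : nat -> {RV P >-> nat})
    (hp : is_pmf p) (hp0 : 0 < p 0%N)
    (C_law : forall i k, P (C i @^-1` [set k]) = (p k)%:E)
    (C_indep : mutually_independent C)
    (b : nat) (v w : R) (hv : 0 < v <= 1) (hw : 0 < w <= 1) (x : int) :
  expect_on P
    (fun omega => let t := time_val (rtau_up C x b%:Z omega) in
                  v ^+ t * w ^ injections C x t omega)
    [set omega | isSome (rtau_up C x b%:Z omega)]
  = if x <= b%:Z
    then Z P C (p 0%N) v x w / Z P C (p 0%N) v b%:Z w
    else 1.
Proof.
rewrite (expect_on_reflected C v w); have b0 : 0 <= b%:Z by [].
have [xb|bx] := leP x b%:Z; last by rewrite reflected_value_ge// ltW.
have fZ z (zb : z <= b%:Z) := reflected_value_Z hp C_law C_indep hp0 hv hw b0 zb.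
have fb := fZ _ (lexx b%:Z); rewrite reflected_value_ge// in fb.
have Zb_neq0 : Z P C (p 0%N) v b%:Z w != 0.
  by apply/eqP => Z0; move/eqP: fb; rewrite Z0 mulr0 oner_eq0.
rewrite fZ//; apply: (mulIf Zb_neq0).
by rewrite divfK// mulrAC -fb mul1r.
Qed.
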